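(* Let $K$ be an algebraically closed field of characteristic $p>0$ and let $f(x)\in K[x]$ be a monic polynomial that has at least two distinct roots. Write $\gcd(f)=p^s\gcd_p(f)$ with $p\nmid\gcd_p(f)$, and $f(x)=g^{p^s}(x)$ for the unique monic nonscalar polynomial $g(x)\in K[x]$. The following statements are equivalent: 1. $G_f=\{e\}$. 2. (a) For each root $\nu$ of the polynomial $g(x)$, $\gcd_p(g_\nu(x))=1$; (b) for each root $\nu'$ of the derivative $g'(x)$ of $g(x)$ such that $g(\nu')\ne0$, $\gcd_p(g_{\nu'}(x))=1$; and (c) $\mathcal R(g)+\mathbb F_p(\lambda-\lambda')\not\subseteq\mathcal R(g)$ for all distinct roots $\lambda$ and $\lambda'$ of $g$ (equivalently, $\mathcal R(f)+\mathbb F_p(\lambda-\lambda')\not\subseteq\mathcal R(f)$ for all distinct roots $\lambda$ and $\lambda'$ of $f$).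
   Context: $\mathrm{Aut}_K(K[x])=\{\sigma_{\lambda,\mu}\mid\lambda\in K^\times,\mu\in K\}$, $\sigma_{\lambda,\mu}(x)=\lambda x+\mu$. The eigengroup of $f$ is $G_f=\{\sigma\in\mathrm{Aut}_K(K[x])\mid\sigma(f)\in K^\times f\}$. For a monic polynomial $f=\sum a_ix^i$ of degree $\ge1$, $\gcd(f):=\gcd\{i\ge1\mid a_i\ne0\}$, and $\gcd(f)=p^s\gcd_p(f)$ with $s\ge0$, $p\nmid\gcd_p(f)$. For $\nu\in K$, $g_\nu(x)\in K[x]$ is the unique monic polynomial with $g_\nu(0)\ne0$ such that $g(x)=(x-\nu)^{i(\nu)}g_\nu(x-\nu)$ for a natural number $i(\nu)\ge0$. $\mathcal R(h)$ is the multiset of roots of $h$ counted with multiplicity, and $\mathcal R(h)+W\subseteq\mathcal R(h)$ means that translation by each element of $W$ maps this multiset into itself. $\mathbb F_p(\lambda-\lambda')$ is the set of $\mathbb F_p$-multiples of $\lambda-\lambda'$. *)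

(* Defs.v *)
From HB Require Import structures.
From mathcomp Require Import all_boot all_order all_algebra.
From mathcomp Require Import finmap multiset.

Set Implicit Arguments.
Unset Strict Implicit.
Unset Printing Implicit Defensive.

Import GRing.Theory.
Local Open Scope mset_scope.
Local Open Scope ring_scope.

Section Eigengroup.
Variable K : fieldType.
Implicit Types (f g h : {poly K}) (sigma : {lrmorphism {poly K} -> {poly K}}).

Definition poly_aut sigma : Prop := bijective sigma.

Definition in_eigengroup f sigma : Prop :=
  poly_aut sigma /\ exists2 c : K, c != 0 & sigma f = c *: f.

Definition eigengroup_trivial f : Prop :=
  forall sigma, in_eigengroup f sigma <-> sigma =1 id.

(* Only meaningful for nonconstant f: the value is 0 on constants. *)
Definition poly_gcd f : nat :=
  \big[gcdn/0%N]_(1 <= i < size f | f`_i != 0) i.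

Definition poly_gcdp (p : nat) f : nat := (poly_gcd f)`_p^'.

(* The g_nu of g(x) = (x - nu)^i g_nu(x - nu), g_nu(0) != 0; the properties
   that determine it (for monic g) are local_factorP and local_factor_uniq. *)
Definition local_factor g (nu : K) : {poly K} :=
  (g %/ ('X - nu%:P) ^+ mup nu g) \Po ('X + nu%:P).

End Eigengroup.

Section RootMultiset.
Variable K : closedFieldType.
Implicit Types (h : {poly K}) (M : {mset K}).

(* Only meaningful for h != 0, see root_msetE. *)
Definition root_mset h : {mset K} :=
  seq_mset (sval (closed_field_poly_normal h)).

Definition mset_translate M (w : K) : {mset K} :=
  seq_mset [seq a + w | a <- M].

Definition translation_stable M (W : K -> Prop) : Prop :=
  forall w, W w -> (mset_translate M w `<=` M)%mset.

(* For p = char K the prime field F_p acts on K by integer multiples. *)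
Definition Fp_multiples (p : nat) (v w : K) : Prop :=
  exists k : 'F_p, w = v *+ k.

Definition no_root_translation (p : nat) h : Prop :=
  forall l l' : K, root h l -> root h l' -> l != l' ->
    ~ translation_stable (root_mset h) (Fp_multiples p (l - l')).

End RootMultiset.

Section Facts.

Lemma affine_lrmorphism (K : fieldType) (la mu : K) :
  exists sigma : {lrmorphism {poly K} -> {poly K}},
    forall q, sigma q = q \Po (la *: 'X + mu%:P).
Proof. by exists (comp_poly (la *: 'X + mu%:P)). Qed.

Lemma poly_autP (K : fieldType) (sigma : {lrmorphism {poly K} -> {poly K}}) :
  poly_aut sigma <->
  exists la mu : K, la != 0 /\ forall q, sigma q = q \Po (la *: 'X + mu%:P).
Proof.
have sigmaC c : sigma c%:P = c%:P by rewrite -alg_polyC linearZ /= rmorph1.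
have sigmaE q : sigma q = q \Po sigma 'X.
  elim/poly_ind: q => [|q c IH]; first by rewrite rmorph0 comp_poly0.
  by rewrite rmorphD rmorphM /= sigmaC IH comp_poly_MXaddC.
split=> [[tau _ sigmaK]|[la [mu [la0 sE]]]].
  have /(congr1 (fun r : {poly K} => (size r).-1)) : sigma (tau 'X) = 'X by [].
  rewrite sigmaE size_comp_poly size_polyX /= => /eqP.
  rewrite muln_eq1 => /andP[_ /eqP sX].
  have sX2 : size (sigma 'X) = 2 by case: (size _) sX => //= n ->.
  exists (sigma 'X)`_1, (sigma 'X)`_0; split.
    have: lead_coef (sigma 'X) != 0 by rewrite lead_coef_eq0 -size_poly_eq0 sX2.
    by rewrite lead_coefE sX2.
  move=> q; rewrite sigmaE; congr (_ \Po _).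
  apply/polyP=> -[|[|i]]; rewrite !coefE /= ?mulr0 ?mulr1 ?addr0 ?add0r //.
  by rewrite nth_default // sX2.
exists (fun q => q \Po (la^-1 *: ('X - mu%:P))) => q; rewrite sE -comp_polyA.
  rewrite comp_polyD comp_polyC comp_polyZ comp_polyX scalerA.
  by rewrite mulfV // scale1r subrK comp_polyXr.
rewrite comp_polyZ comp_polyB comp_polyC comp_polyX addrK scalerA.
by rewrite mulVf // scale1r comp_polyXr.
Qed.

Lemma local_factorP (K : fieldType) (g : {poly K}) (nu : K) :
    g \is monic ->
  [/\ local_factor g nu \is monic, (local_factor g nu).[0] != 0
    & g = ('X - nu%:P) ^+ mup nu g * (local_factor g nu \Po ('X - nu%:P))].
Proof.
move=> gmon; have g0 : g != 0 by apply: monic_neq0.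
have dv : ('X - nu%:P) ^+ mup nu g %| g by rewrite -mup_geq.
set q := g %/ ('X - nu%:P) ^+ mup nu g.
have Eg : g = q * ('X - nu%:P) ^+ mup nu g by rewrite divpK.
have qmon : q \is monic.
  by rewrite -(monicMr q (monic_exp (mup nu g) (monicXsubC nu))) -Eg.
have qnu : ~~ root q nu.
  apply/negP; rewrite -dvdp_XsubCl => /dvdpP [r Er].
  have : ('X - nu%:P) ^+ (mup nu g).+1 %| g.
    by rewrite {2}Eg Er exprS -mulrA dvdp_mull.
  by rewrite -mup_geq // ltnn.
have XK : ('X + nu%:P) \Po ('X - nu%:P) = 'X.
  by rewrite comp_polyD comp_polyX comp_polyC subrK.
split.
- rewrite /local_factor -/q -[nu%:P]opprK -polyCN monicE lead_coef_comp.
    by rewrite lead_coefXsubC expr1n mulr1 -monicE.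
  by rewrite size_XsubC.
- rewrite /local_factor -/q horner_comp hornerD hornerX hornerC add0r.
  exact: qnu.
- by rewrite /local_factor -/q -comp_polyA XK comp_polyXr mulrC.
Qed.

Lemma local_factor_uniq (K : fieldType) (g h : {poly K}) (nu : K) (i : nat) :
    g \is monic -> h.[0] != 0 ->
    g = ('X - nu%:P) ^+ i * (h \Po ('X - nu%:P)) ->
  i = mup nu g /\ h = local_factor g nu.
Proof.
move=> gmon h0 Eg; have g0 : g != 0 by apply: monic_neq0.
have hn : ~~ root (h \Po ('X - nu%:P)) nu.
  by rewrite rootE horner_comp hornerXsubC subrr.
have Ei : mup nu g = i.
  by rewrite Eg (mupMl _ hn) mup_XsubCX eqxx.
split=> //.
rewrite /local_factor Ei {1}Eg mulKp ?expf_neq0 ?polyXsubC_eq0 //.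
by rewrite -comp_polyA comp_polyB comp_polyX comp_polyC addrK comp_polyXr.
Qed.

Lemma root_msetE (K : closedFieldType) (h : {poly K}) (x : K) :
  h != 0 -> root_mset h x = mup x h.
Proof.
rewrite /root_mset mset_seqE; case: closed_field_poly_normal => r /= Eh h0.
rewrite Eh -mul_polyC mupMr ?mu_prod_XsubC //.
by rewrite rootE hornerC lead_coef_eq0.
Qed.

Lemma mset_translateE (K : closedFieldType) (M : {mset K}) (w x : K) :
  mset_translate M w x = M (x - w).
Proof.
rewrite /mset_translate mset_seqE count_map -[in RHS](seq_mset_id M) mset_seqE.
by apply: eq_count => a /=; rewrite -subr_eq opprK eq_sym -subr_eq eq_sym.
Qed.

End Facts.

(* Main.v *)
(* A nontrivial affine substitution x |-> la x + mu is either a translation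
   (la = 1) or a scaling about its fixed point nu = mu / (1 - la).  If g is an
   eigenvector of the scaling then so is g_nu, with eigenvalue 1 because
   g_nu(0) != 0; this means that la^i = 1 for every exponent i of g_nu, and such
   a la != 1 exists iff gcd_p(g_nu) != 1.  When g(nu) != 0, comparing the
   derivatives at nu of both sides of g(la x + mu) = g(x) gives g'(nu) = 0, so
   only the points nu of conditions (a) and (b) matter.  Translations fixing g
   are excluded by (c).  Passing from g to f = g^(p^s) changes nothing because
   the Frobenius map is injective. *)
Require Import Defs.
From mathcomp Require Import all_boot all_order all_algebra.
From mathcomp Require Import finmap multiset.

Set Implicit Arguments.
Unset Strict Implicit.
Unset Printing Implicit Defensive.

Import GRing.Theory.
Local Open Scope ring_scope.

(** * Exponent gcds, roots of unity and Frobenius powers *)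

Lemma dvdn_poly_gcdP (K : fieldType) (h : {poly K}) (d : nat) :
  reflect (forall i, h`_i != 0 -> (d %| i)%N) (d %| poly_gcd h)%N.
Proof.
have -> : (d %| poly_gcd h)%N
    = all (fun i => (h`_i != 0) ==> (d %| i)%N) (index_iota 1 (size h)).
  rewrite /poly_gcd; elim: (index_iota _ _) => [|i r IH] /=.
    by rewrite big_nil dvdn0.
  by rewrite big_cons; case: (h`_i != 0); rewrite //= dvdn_gcd IH.
apply: (iffP allP) => [dvd_h i hi0 | dvd_h i _]; last exact/implyP/dvd_h.
(* The range of [poly_gcd] omits 0, which everything divides, and the exponents from [size h] on,
   whose coefficients vanish. *)
have [->|i_gt0] := posnP i; first exact: dvdn0.
apply: (implyP (dvd_h i _)) => //; rewrite mem_index_iota i_gt0 ltnNge.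
by apply: contra hi0 => le_h_i; rewrite nth_default.
Qed.

Lemma coef_comp_scaleX (R : comNzRingType) (h : {poly R}) (la : R) (i : nat) :
  (h \Po (la *: 'X))`_i = la ^+ i * h`_i.
Proof.
rewrite coef_comp_poly.
under eq_bigr => j _ do rewrite exprZn coefZ coefXn.
have [lt_i|le_i] := ltnP i (size h).
  rewrite (bigD1 (Ordinal lt_i)) //= eqxx mulr1 mulrC big1 ?addr0 // => j.
  by rewrite -val_eqE /= eq_sym => /negPf->; rewrite !mulr0.
rewrite nth_default // mulr0 big1 // => j _.
by rewrite gtn_eqF ?mulr0 // (leq_trans (ltn_ord j)).
Qed.

(** A root of [1 + X + ... + X^(m-1)] works: at 1 this polynomial takes the value [m], nonzero in
    [K]. *)
Lemma exists_nontrivial_unity_root (K : closedFieldType) (m : nat) :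
  m%:R != 0 :> K -> m != 1%N -> exists2 la : K, la != 1 & la ^+ m = 1.
Proof.
move=> m0 m1; have m_gt0 : (0 < m)%N by case: m m0 {m1}; rewrite ?eqxx.
pose P : {poly K} := \poly_(i < m) 1.
have sP : size P = m by rewrite size_poly_eq // oner_neq0.
have [la] : exists la, root P la by apply/closed_rootP; rewrite sP.
rewrite rootE horner_poly => /eqP P_la.
have S0 : \sum_(i < m) la ^+ i = 0.
  by rewrite -[RHS]P_la; apply: eq_bigr => i _; rewrite mul1r.
exists la; last by apply/eqP; rewrite -subr_eq0 subrX1 S0 mulr0.
apply: contra m0 => /eqP la1; rewrite -S0 la1.
under eq_bigr => i _ do rewrite expr1n.
by rewrite sumr_const card_ord.
Qed.

(** The n-th power map is additive, so [x^n = y^n] gives [(x - y)^n = 0]. *)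
Lemma expr_pchar_inj (R : idomainType) (n : nat) :
  [pchar R].-nat n -> injective (fun x : R => x ^+ n).
Proof.
move=> n_pchar x y /= /eqP.
rewrite -subr_eq0 -exprNn_pchar // -exprDn_pchar // expf_eq0 subr_eq0.
by case/andP => _ /eqP.
Qed.

(** Since n-th powers are additive, it suffices to extract n-th roots of the coefficients, which
    exist in [K]; Horner's scheme takes them one at a time. *)
Lemma comp_polyXn_expr (K : closedFieldType) (n : nat) (h : {poly K}) :
  [pchar K].-nat n -> exists g : {poly K}, g ^+ n = h \Po 'X^n.
Proof.
move=> n_pchar; have n_gt0 : (0 < n)%N by case: n n_pchar.
elim/poly_ind: h => [|h c [g gE]].
  by exists 0; rewrite comp_poly0 expr0n gtn_eqF.
have [r] : exists r, root ('X^n - c%:P) r.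
  by apply/closed_rootP; rewrite size_XnsubC // eqSS -lt0n.
rewrite rootE !hornerE subr_eq0 => /eqP rE.
exists (g * 'X + r%:P); rewrite exprDn_pchar.
  by rewrite exprMn gE -polyC_exp rE comp_poly_MXaddC.
by rewrite (eq_pnat _ (pchar_poly K)).
Qed.

(** * Affine substitutions and the eigengroup *)

Section Affine.
Variable K : fieldType.
Implicit Types (f g h : {poly K}) (la mu nu c w : K).

Lemma size_affine la mu : la != 0 -> size (la *: 'X + mu%:P) = 2%N.
Proof.
move=> la0; rewrite size_polyDl size_scale ?size_polyX //.
by rewrite (leq_ltn_trans (size_polyC_leq1 _)).
Qed.

Lemma affine_eigenvalue f la mu c : f \is monic -> la != 0 ->
  f \Po (la *: 'X + mu%:P) = c *: f -> c = la ^+ (size f).-1.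
Proof.
move=> f_monic la0 /(congr1 lead_coef).
rewrite lead_coef_comp ?size_affine // lead_coefZ (monicP f_monic) mulr1 mul1r.
rewrite lead_coefDl ?lead_coefZ ?lead_coefX ?mulr1 //.
by rewrite size_scale // size_polyX (leq_ltn_trans (size_polyC_leq1 _)).
Qed.

Lemma eigengroup_trivialP f : f \is monic ->
  eigengroup_trivial f <->
  forall la mu c, la != 0 -> f \Po (la *: 'X + mu%:P) = c *: f ->
    la = 1 /\ mu = 0.
Proof.
move=> f_monic; split=> [trivial_f la mu c la0 Ef | affine_f sigma].
  have [sigma sigmaE] := affine_lrmorphism la mu.
  have /trivial_f/(_ 'X) : in_eigengroup f sigma.
    split; first by apply/poly_autP; exists la, mu.
    exists c; last by rewrite sigmaE.
    (* The eigenvalue is a power of [la], hence nonzero as membership requires. *)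
    by rewrite (affine_eigenvalue f_monic la0 Ef) expf_neq0.
  rewrite sigmaE comp_polyX => E.
  have := congr1 (fun q : {poly K} => q`_0) E.
  have := congr1 (fun q : {poly K} => q`_1) E.
  rewrite /= !coefD !coefZ !coefX !coefC /= mulr0 mulr1 addr0 add0r.
  by move=> la1 mu0; split.
split=> [[/poly_autP [la [mu [la0 sigmaE]]] [c _ Ec]] q | sigma_id].
  rewrite sigmaE in Ec; have [la1 mu0] := affine_f _ _ _ la0 Ec.
  by rewrite sigmaE la1 mu0 scale1r addr0 comp_polyXr.
split; first by exists id => q; rewrite sigma_id.
by exists 1; rewrite ?oner_neq0 // scale1r sigma_id.
Qed.

Lemma eigengroup_trivial_expr f n : f \is monic -> [pchar K].-nat n ->
  eigengroup_trivial (f ^+ n) <-> eigengroup_trivial f.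
Proof.
move=> f_monic n_pchar; have fn_monic := monic_exp n f_monic.
have comp_exp q : (f ^+ n) \Po q = (f \Po q) ^+ n by rewrite rmorphXn.
apply: iff_trans (eigengroup_trivialP fn_monic) _.
apply: iff_trans (iff_sym (eigengroup_trivialP f_monic)).
split=> triv la mu c la0 Ef.
  by apply: (triv la mu (c ^+ n)) => //; rewrite comp_exp Ef exprZn.
(* The eigenvalue of [f ^+ n] is [la] to the degree of [f ^+ n]; the witness is its n-th root. *)
apply: (triv la mu (la ^+ (size f).-1)) => //.
apply: (@expr_pchar_inj _ n); first by rewrite (eq_pnat _ (pchar_poly K)).
rewrite /= -comp_exp Ef (affine_eigenvalue fn_monic la0 Ef).
by rewrite size_exp exprZn exprM.
Qed.

(** A constant local factor would make [g] a power of [X - nu], with at most one root. *)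
Lemma size_local_factor_gt1 g nu : g \is monic ->
  (exists a b, [/\ a != b, root g a & root g b]) ->
  (1 < size (local_factor g nu))%N.
Proof.
move=> g_monic [a [b [ab ga gb]]].
have [h_monic _ gE] := local_factorP nu g_monic.
rewrite ltnNge; apply/negP => /size1_polyC hC.
move: h_monic gE; rewrite hC monicE lead_coefC => /eqP ->.
rewrite comp_polyC mulr1 => gE.
have root_nu x : root g x -> x = nu.
  rewrite gE; case: (mup _ _) => [|n]; first by rewrite expr0 (negPf (root1 _)).
  by rewrite root_exp_XsubC => /eqP.
by rewrite (root_nu a ga) (root_nu b gb) eqxx in ab.
Qed.

(** The substitution fixes [nu] and multiplies [X - nu] by [la], so in the coordinate centred at
    [nu] it scales the variable of the local factor. *)
Lemma scaling_local_factor g la nu : g \is monic -> la != 0 ->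
  (exists c, g \Po (la *: 'X + (nu - la * nu)%:P) = c *: g) <->
  local_factor g nu \Po (la *: 'X) = local_factor g nu.
Proof.
move=> g_monic la0; have [_ + +] := local_factorP nu g_monic.
move: (local_factor g nu) (mup nu g) => h i h0 gE.
have XS : ('X - nu%:P) \Po (la *: 'X + (nu - la * nu)%:P) = la *: ('X - nu%:P).
  by rewrite comp_polyB comp_polyX comp_polyC polyCB polyCM scalerBr -!mul_polyC
             addrA addrAC addrK.
have compE : g \Po (la *: 'X + (nu - la * nu)%:P)
    = ('X - nu%:P) ^+ i * ((la ^+ i *: (h \Po (la *: 'X))) \Po ('X - nu%:P)).
  rewrite gE rmorphM rmorphXn /= -comp_polyA XS exprZn comp_polyZ -comp_polyA.
  by rewrite comp_polyZ comp_polyX -scalerAl -scalerAr.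
split=> [[c]|h_la].
  rewrite compE gE scalerAr -[c *: (_ \Po _)]comp_polyZ => /mulfI E.
  have {}E := E (expf_neq0 _ (monic_neq0 (monicXsubC nu))).
  have {}E : la ^+ i *: (h \Po (la *: 'X)) = c *: h.
    have := congr1 (fun q => q \Po ('X + nu%:P)) E.
    by rewrite -!comp_polyA comp_polyB comp_polyX comp_polyC addrK !comp_polyXr.
  (* Scaling fixes the point 0, where [h] does not vanish, so evaluation there determines [c]. *)
  have Ec : la ^+ i = c.
    have := congr1 (horner^~ 0) E.
    rewrite !hornerZ horner_comp hornerZ hornerX mulr0 => /mulIf; exact.
  by apply: (scalerI (expf_neq0 i la0)); rewrite E Ec.
by exists (la ^+ i); rewrite compE h_la comp_polyZ -scalerAr -gE.
Qed.

End Affine.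

(* The multiplicative order of [la] is prime to [p], so it divides
   [poly_gcd h] only through [poly_gcdp p h]. *)
Lemma scaling_fixedP (K : closedFieldType) (p : nat) (h : {poly K}) :
    p \in [pchar K] -> (1 < size h)%N ->
  poly_gcdp p h <> 1%N <->
  exists la : K, [/\ la != 0, la != 1 & h \Po (la *: 'X) = h].
Proof.
move=> charKp size_h; have p_prime := pcharf_prime charKp.
split=> [gcdp_h | [la [la0 la1 h_la]]].
  (* Being prime to [p], this number stays nonzero in [K], so it admits a nontrivial root of
     unity. *)
  have gcdp_h0 : (poly_gcdp p h)%:R != 0 :> K.
    rewrite natf_neq0_pchar (eq_pnat _ (eq_negn (pcharf_eq charKp))).
    exact: part_pnat.
  have [la la1 la_gcdp] :=
    exists_nontrivial_unity_root gcdp_h0 (introN eqP gcdp_h).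
  have gcdp_gt0 : (0 < poly_gcdp p h)%N by apply: part_gt0.
  exists la; split=> //.
    apply/eqP => la0; move/eqP: la_gcdp.
    by rewrite la0 expr0n gtn_eqF // eq_sym oner_eq0.
  apply/polyP => i; rewrite coef_comp_scaleX.
  have [->|hi0] := eqVneq h`_i 0; first by rewrite mulr0.
  have /dvdnP[k ->] : (poly_gcdp p h %| i)%N.
    exact: (dvdn_poly_gcdP _ _ (dvdn_part _ _)).
  by rewrite mulnC exprM la_gcdp expr1n mul1r.
have la_i i : h`_i != 0 -> la ^+ i = 1.
  move=> hi0; apply: (mulIf hi0).
  by rewrite -coef_comp_scaleX h_la mul1r.
have h_neq0 : h != 0 by rewrite -size_poly_gt0 ltnW.
have lead_h : h`_(size h).-1 != 0 by rewrite -lead_coefE lead_coef_eq0.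
have deg_gt0 : (0 < (size h).-1)%N by rewrite -ltnS prednK // ltnW.
(* The degree is a positive exponent of [h], so [la] is a root of unity of some order [n]. *)
have [n n_prim _] := prim_order_exists deg_gt0 (la_i _ lead_h).
have n_gcd : (n %| poly_gcd h)%N.
  by apply/dvdn_poly_gcdP => i /la_i/eqP; rewrite -(prim_order_dvd n_prim).
have n_p' : p^'.-nat n.
  by rewrite -(eq_pnat _ (eq_negn (pcharf_eq charKp))) (pchar_prim_root n_prim).
have gcd_gt0 : (0 < poly_gcd h)%N.
  have : (poly_gcd h %| (size h).-1)%N by apply: (dvdn_poly_gcdP _ _ (dvdnn _)).
  exact: dvdn_gt0.
have := partn_dvd p^' gcd_gt0 n_gcd; rewrite part_pnat_id // -/(poly_gcdp p h).
move=> + gcdp1; rewrite gcdp1 dvdn1 => /eqP n1.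
move: n_prim la1; rewrite n1 => /prim_expr_order; rewrite expr1 => ->.
by rewrite eqxx.
Qed.

(** * Translations of the root multiset *)

Section RootTranslation.
Variable K : closedFieldType.
Implicit Types (g : {poly K}) (w : K).

Lemma prod_root_mset g : g \is monic ->
  g = \prod_(a <- sval (closed_field_poly_normal g)) ('X - a%:P).
Proof.
move=> g_monic; case: closed_field_poly_normal => r /= {1}->.
by rewrite (monicP g_monic) scale1r.
Qed.

(** Substituting [X - w] adds [w] to every root, and a monic polynomial over [K] is the product over
    its root multiset. *)
Lemma mset_translate_rootP g w : g \is monic ->
  mset_translate (root_mset g) w = root_mset g <-> g \Po ('X - w%:P) = g.
Proof.
move=> g_monic; rewrite /mset_translate /root_mset.
have := prod_root_mset g_monic; set r := sval _ => gE.
have compE : g \Po ('X - w%:P) = \prod_(a <- map (+%R^~ w) r) ('X - a%:P).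
  rewrite gE rmorph_prod big_map; apply: eq_bigr => a _ /=.
  by rewrite comp_polyB comp_polyX comp_polyC polyCD opprD addrAC addrA.
have perm_r : perm_eq (map (+%R^~ w) (seq_mset r)) (map (+%R^~ w) r).
  exact/perm_map/perm_eq_seq_mset.
rewrite compE; split=> [/eq_seq_msetP perm_rw|prod_rw].
  rewrite [RHS]gE; apply: perm_big.
  by rewrite -(permPl perm_r).
apply/eq_seq_msetP; rewrite (permPl perm_r).
by apply: prod_XsubC_eq; rewrite prod_rw.
Qed.

Lemma Fp_multiplesMn (p n : nat) w : p \in [pchar K] ->
  Fp_multiples p w (w *+ n).
Proof.
move=> charKp; exists n%:R; rewrite val_Fp_nat ?(pcharf_prime charKp) //.
by rewrite -mulr_natr -[RHS]mulr_natr GRing.natr_mod_pchar.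
Qed.

(** Inclusion for [w] and for [(p - 1) w = - w] bounds the multiplicities both ways, which forces
    equality. *)
Lemma translation_stableP (p : nat) g w : p \in [pchar K] -> g \is monic ->
  translation_stable (root_mset g) (Fp_multiples p w) <-> g \Po ('X - w%:P) = g.
Proof.
move=> charKp g_monic; split=> [stable|g_w _ [k ->]].
  apply/(mset_translate_rootP w g_monic)/msetP => x; apply/eqP.
  have /msubsetP := stable _ (Fp_multiplesMn 1 w charKp).
  have /msubsetP := stable _ (Fp_multiplesMn p.-1 w charKp).
  move=> /(_ (x - w)) le1 /(_ x); rewrite mulr1n eqn_leq => -> /=.
  move: le1; rewrite !mset_translateE -addrA -opprD -mulrS.
  by rewrite prednK ?prime_gt0 ?(pcharf_prime charKp) // mulrn_pchar // subr0.
suff /(mset_translate_rootP _ g_monic) -> : g \Po ('X - (w *+ k)%:P) = g.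
  by apply: msubset_refl.
elim: {k}(k : nat) => [|k IH]; first by rewrite mulr0n subr0 comp_polyXr.
rewrite -[in RHS]IH -[in RHS]g_w -comp_polyA; congr (_ \Po _).
by rewrite comp_polyB comp_polyX comp_polyC mulrS polyCD opprD addrA addrAC.
Qed.

(** If translation by [w] fixes [g] and [l] is a root, so is [l - w]; thus [w] is automatically a
    difference of roots. *)
Lemma no_root_translationP (p : nat) g : p \in [pchar K] -> g \is monic ->
    (1 < size g)%N ->
  no_root_translation p g <-> forall w, g \Po ('X - w%:P) = g -> w = 0.
Proof.
move=> charKp g_monic size_g; split=> [no_trans w g_w | no_trans l l' _ _ ll'].
  have [l gl] : exists l, root g l by apply/closed_rootP; rewrite gtn_eqF.
  have glw : root g (l - w).
    by move: gl; rewrite -{1}g_w !rootE horner_comp hornerXsubC.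
  apply/eqP/contraT => w0; case: (no_trans l (l - w)) => //.
    by rewrite -subr_eq0 subKr.
  by rewrite subKr; apply/translation_stableP.
move=> /(translation_stableP _ charKp g_monic)/no_trans/eqP.
by rewrite subr_eq0 (negPf ll').
Qed.

End RootTranslation.

(** * The polynomial [g] and the equivalence *)

Theorem theorem4p23 (K : closedFieldType) (p : nat) (f : {poly K}) (s : nat)
    (charKp : p \in [pchar K])
    (f_monic : f \is monic)
    (f_roots : exists a b : K, [/\ a != b, root f a & root f b])
    (gcd_f : poly_gcd f = (p ^ s * poly_gcdp p f)%N) :
  (exists! g : {poly K}, [/\ g \is monic, (1 < size g)%N & f = g ^+ (p ^ s)]) /\
  forall g : {poly K}, g \is monic -> (1 < size g)%N -> f = g ^+ (p ^ s) ->
    (eigengroup_trivial f <->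
       [/\ forall nu : K, root g nu -> poly_gcdp p (local_factor g nu) = 1%N,
           forall nu' : K, root g^`() nu' -> g.[nu'] != 0 ->
             poly_gcdp p (local_factor g nu') = 1%N
         & no_root_translation p g])
    /\ (no_root_translation p g <-> no_root_translation p f).
Proof.
have q_pchar : [pchar K].-nat (p ^ s)%N.
  rewrite (eq_pnat _ (pcharf_eq charKp)) pnatX.
  by rewrite pnat_id ?(pcharf_prime charKp).
have q_pchar_poly : [pchar {poly K}].-nat (p ^ s)%N.
  by rewrite (eq_pnat _ (pchar_poly K)).
have q_gt0 : (0 < p ^ s)%N by rewrite expn_gt0 prime_gt0 ?(pcharf_prime charKp).
have size_f : (1 < size f)%N.
  have [a [_ [_ fa _]]] := f_roots; apply: root_size_gt1 fa.
  exact: monic_neq0.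
split.
  (* The gcd hypothesis puts [f] in the form [F(X^(p^s))], where [F] collects the coefficients of
     [f] at multiples of [p ^ s]. *)
  have [g gE] := comp_polyXn_expr (\poly_(i < size f) f`_(p ^ s * i)%N) q_pchar.
  have {}gE : f = g ^+ (p ^ s).
    rewrite gE; apply/polyP => i; rewrite coef_comp_poly_Xn // coef_poly.
    have [/dvdnP[k ->]|/negP q_i] := boolP (p ^ s %| i)%N; last first.
      apply/eqP; apply: contra_notT q_i; apply: dvdn_poly_gcdP.
      by rewrite gcd_f dvdn_mulr.
    (* The bound [size f] on [F] loses nothing: beyond it [p ^ s * k >= k], so that coefficient of
       [f] is 0. *)
    rewrite mulnK // mulnC; case: ltnP => // le_k.
    by rewrite nth_default // (leq_trans le_k) // leq_pmull.
  exists g; split=> [|g' [_ _ fE]]; last first.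
    by apply: (expr_pchar_inj q_pchar_poly); rewrite /= -fE -gE.
  have g_monic : g \is monic.
    rewrite monicE; apply/eqP/(expr_pchar_inj q_pchar).
    by rewrite /= -lead_coef_exp -gE expr1n; apply/eqP.
  split=> //; have [a [_ [_ fa _]]] := f_roots.
  apply: (@root_size_gt1 _ a); first exact: monic_neq0.
  by rewrite -(root_exp (mulrC _ _) q_gt0) -gE.
move=> g g_monic size_g fE; split; last first.
  apply: iff_trans (no_root_translationP charKp g_monic size_g) _.
  apply: iff_trans (iff_sym (no_root_translationP charKp f_monic size_f)).
  (* By injectivity of Frobenius, [g] and its [p ^ s]-th power are fixed by the same
     translations. *)
  split=> no_trans w E; apply: no_trans; last by rewrite fE rmorphXn /= E.
  by apply: (expr_pchar_inj q_pchar_poly); rewrite /= -rmorphXn -fE.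
have g_roots : exists a b : K, [/\ a != b, root g a & root g b].
  have [a [b [ab fa fb]]] := f_roots; exists a, b.
  by move: fa fb; rewrite fE !(root_exp (mulrC _ _) q_gt0).
(* This holds at every point [nu], because two distinct roots make every local factor
   nonconstant. *)
have gcdp_scaling nu : poly_gcdp p (local_factor g nu) <> 1%N <->
    exists la : K, [/\ la != 0, la != 1 &
      exists c, g \Po (la *: 'X + (nu - la * nu)%:P) = c *: g].
  have size_h := size_local_factor_gt1 nu g_monic g_roots.
  apply: iff_trans (scaling_fixedP charKp size_h) _.
  by split=> -[la [la0 la1 /(scaling_local_factor nu g_monic la0) E]];
    exists la.
rewrite fE; apply: iff_trans (eigengroup_trivial_expr g_monic q_pchar) _.
apply: iff_trans (eigengroup_trivialP g_monic) _.
split=> [triv | [root_g root_dg /no_root_translationP no_trans] la mu c la0 Ec].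
  have gcdp1 nu : poly_gcdp p (local_factor g nu) = 1%N.
    apply/eqP; apply: contraT => /eqP/gcdp_scaling[la [la0 la1 [c Ec]]].
    by have [/eqP] := triv _ _ _ la0 Ec; rewrite (negPf la1).
  split=> //; apply/(no_root_translationP charKp g_monic size_g) => w g_w.
  (* A translation is the case [la = 1], with eigenvalue 1. *)
  have [||_ /eqP] := triv 1 (- w) 1; rewrite ?oner_neq0 //.
    by rewrite !scale1r polyCN.
  by rewrite oppr_eq0 => /eqP.
have [la1|la1] := eqVneq la 1.
  split=> //; apply: oppr_inj; rewrite oppr0; apply: no_trans => //.
  have c1 := affine_eigenvalue g_monic la0 Ec.
  by move: Ec; rewrite c1 la1 expr1n !scale1r polyCN opprK.
(* The fixed point of the affine map, hence the centre of the scaling. *)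
pose nu := mu / (1 - la).
have la1' : 1 - la != 0 by rewrite subr_eq0 eq_sym.
have muE : mu = nu - la * nu by rewrite -{1}[nu]mul1r -mulrBl mulrC divfK.
rewrite muE in Ec.
suff gcdp1 : poly_gcdp p (local_factor g nu) = 1%N.
  exfalso; case: (gcdp_scaling nu) => _; apply=> //.
  by exists la; split=> //; exists c.
(* Condition (a) covers a root [nu]; otherwise (b) applies once [g'(nu) = 0] is known. *)
have [/root_g // | g_nu] := boolP (root g nu).
apply: root_dg => //; rewrite rootE.
have fix_nu : (la *: 'X + (nu - la * nu)%:P).[nu] = nu.
  by rewrite hornerD hornerZ hornerX hornerC addrC subrK.
have /(congr1 (fun q => q^`().[nu])) := Ec.
have c1 : c = 1.
  have /(congr1 (horner^~ nu)) := Ec.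
  rewrite horner_comp fix_nu hornerZ -{1}[g.[nu]]mul1r.
  by move=> /(mulIf g_nu).
(* The chain rule at the fixed point gives [g'(nu) * la = g'(nu)] with [la != 1]. *)
rewrite c1 scale1r deriv_comp derivD derivZ derivX derivC addr0 hornerM.
rewrite horner_comp fix_nu hornerZ hornerC mulr1 => /eqP.
rewrite -subr_eq0 -{2}[_.[nu]]mulr1 -mulrBr mulf_eq0 subr_eq0.
by rewrite (negPf la1) orbF.
Qed.
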